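(* Let $f_t$ be a $\mathbb{R}^K$-valued random vector of factors, $y_{t+1}$ a real response generated by $y_{t+1}=g(\phi_1'f_t,\dots,\phi_L'f_t,\epsilon_{t+1})$, and let the $p$-dimensional predictor follow the factor model $x_t=Bf_t+u_t$, where $B\in\mathbb{R}^{p\times K}$ is known with $B'B$ invertible, and $f_t$, $u_t$, $\epsilon_{t+1}$ are mutually independent. Let $$\widehat f_t=(B'B)^{-1}B'x_t=f_t+u_t^*,\qquad u_t^*=(B'B)^{-1}B'u_t .$$ Let $(g_s,\eta_{s+1},u_s^* )$ be an independent copy of $(f_t,y_{t+1},u_t^* )$ and let $\widehat g_s=g_s+u_s^*$. Then the matrix $$M_{dr}=E\Big[\big\{2\,\mathrm{var}(f_t)-E[(f_t-g_s)(f_t-g_s)'\mid y_{t+1},\eta_{s+1}]\big\}^2\Big]$$ is unchanged if $f_t$ and $g_s$ are replaced by $\widehat f_t$ and $\widehat g_s$, that is, $$M_{dr}=E\Big[\big\{2\,\mathrm{var}(\widehat f_t)-E[(\widehat f_t-\widehat g_s)(\widehat f_t-\widehat g_s)'\mid y_{t+1},\eta_{s+1}]\big\}^2\Big].$$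
   Context: Here $\{A\}^2=AA$ denotes the matrix square of a symmetric matrix $A$, primes denote transposes, and $\mathrm{var}$ of a random vector is its covariance matrix. The moments appearing in the definitions of the matrices are assumed to exist. $g$ is an unknown measurable function, and $\phi_1,\dots,\phi_L\in\mathbb{R}^K$ are fixed vectors. *)

(* Defs.v *)
From HB Require Import structures.
From mathcomp Require Import all_boot all_order all_algebra.
From mathcomp Require Import all_classical all_reals all_analysis.

Set Implicit Arguments.
Unset Strict Implicit.
Unset Printing Implicit Defensive.

Import Order.TTheory GRing.Theory Num.Theory.
Import numFieldNormedType.Exports.

Local Open Scope classical_set_scope.
Local Open Scope ring_scope.

(* Real matrices carry the sigma-algebra generated by their entries, i.e. the
   Borel sigma-algebra of R^(m * n), so that a random vector is a random
   variable with values in 'cV[R]_n. *)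
Definition mx_measure_display : measure_display.
Proof. exact. Qed.

Definition mx_measurable (R : realType) (m n : nat) : set (set 'M[R]_(m, n)) :=
  <<s \bigcup_(ij : 'I_m * 'I_n)
        preimage_set_system setT (fun A : 'M[R]_(m, n) => A ij.1 ij.2)
          (@measurable _ (measurableTypeR R)) >>.

Section mx_measurable.
Context (R : realType) (m n : nat).

Let mx_measurable0 : @mx_measurable R m n set0.
Proof. exact: sigma_algebra0. Qed.

Let mx_measurableC (A : set 'M[R]_(m, n)) :
  mx_measurable A -> mx_measurable (~` A).
Proof. exact: sigma_algebraC. Qed.

Let mx_measurable_bigcup (F : (set 'M[R]_(m, n))^nat) :
  (forall i, mx_measurable (F i)) -> mx_measurable (\bigcup_i (F i)).
Proof. exact: sigma_algebra_bigcup. Qed.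

HB.instance Definition _ := @isMeasurable.Build mx_measure_display
  'M[R]_(m, n) (@mx_measurable R m n)
  mx_measurable0 mx_measurableC mx_measurable_bigcup.

End mx_measurable.

Section random_elements.
Context d (T : measurableType d) (R : realType) (P : probability T R).

Definition independent2 d1 d2 (S1 : measurableType d1) (S2 : measurableType d2)
    (X : T -> S1) (Y : T -> S2) : Prop :=
  forall A B, measurable A -> measurable B ->
    P (X @^-1` A `&` Y @^-1` B) = (P (X @^-1` A) * P (Y @^-1` B))%E.

(* Mutual independence; the product rule for two of the three variables is the
   instance where the third set is setT. *)
Definition independent3 d1 d2 d3 (S1 : measurableType d1)
    (S2 : measurableType d2) (S3 : measurableType d3)
    (X : T -> S1) (Y : T -> S2) (Z : T -> S3) : Prop :=
  forall A B C, measurable A -> measurable B -> measurable C ->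
    P (X @^-1` A `&` Y @^-1` B `&` Z @^-1` C) =
    (P (X @^-1` A) * P (Y @^-1` B) * P (Z @^-1` C))%E.

Definition same_law d1 (S : measurableType d1) (X Y : T -> S) : Prop :=
  forall A, measurable A -> P (X @^-1` A) = P (Y @^-1` A).

Definition independent_copy d1 (S : measurableType d1) (X Y : T -> S) : Prop :=
  same_law X Y /\ independent2 X Y.

(* Z is a version of E[X | Y]: conditional expectations are only determined up
   to almost sure equality. *)
Definition is_condexp d1 (S : measurableType d1)
    (X : T -> R) (Y : T -> S) (Z : T -> R) : Prop :=
  [/\ measurable_fun setT (Z : g_sigma_algebra_preimageType Y -> R),
      P.-integrable setT (EFin \o Z) &
      forall A, g_sigma_algebra_preimage Y A ->
        (\int[P]_(w in A) (Z w)%:E = \int[P]_(w in A) (X w)%:E)%E].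

Definition is_condexp_mx d1 (S : measurableType d1) (m n : nat)
    (X : T -> 'M[R]_(m, n)) (Y : T -> S) (Z : T -> 'M[R]_(m, n)) : Prop :=
  forall i j, is_condexp (fun w => X w i j) Y (fun w => Z w i j).

Definition integrable_mx (m n : nat) (X : T -> 'M[R]_(m, n)) : Prop :=
  forall i j, P.-integrable setT (fun w => (X w i j)%:E).

Definition expectation_mx (m n : nat) (X : T -> 'M[R]_(m, n)) : 'M[R]_(m, n) :=
  \matrix_(i, j) fine ('E_P[fun w => X w i j])%E.

Definition square_integrable (n : nat) (X : T -> 'cV[R]_n) : Prop :=
  forall i, (fun w => X w i 0) \in Lfun P 2%:E.

Definition covariance_mx (n : nat) (X : T -> 'cV[R]_n) : 'M[R]_n :=
  \matrix_(i, j) fine (covariance P (fun w => X w i 0) (fun w => X w j 0)).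

(* For X the factor vector and C a version of E[(X - X')(X - X')' | y, eta],
   the random matrix {2 var(X) - C}^2. *)
Definition dr_integrand (n : nat) (X : T -> 'cV[R]_n) (C : T -> 'M[R]_n) :
    T -> 'M[R]_n :=
  fun w => let D := 2%:R *: covariance_mx X - C w in D *m D.

Definition dr_matrix (n : nat) (X : T -> 'cV[R]_n) (C : T -> 'M[R]_n) :
    'M[R]_n :=
  expectation_mx (dr_integrand X C).

End random_elements.

Definition outer_diff (T : Type) (R : realType) (n : nat)
    (X Y : T -> 'cV[R]_n) : T -> 'M[R]_n :=
  fun w => (X w - Y w) *m (X w - Y w)^T.

Definition least_squares (R : realType) (p K : nat) (B : 'M[R]_(p, K))
    (v : 'cV[R]_p) : 'cV[R]_K :=
  invmx (B^T *m B) *m B^T *m v.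

(* Main.v *)
(* Write v for the projected noise of the first copy and us for that of the
   second.  Mutual independence of f, u, eps and of the two copies makes (v, us)
   independent of the signals together with the conditioning variables.  When
   (fhat - ghat)(fhat - ghat)' is expanded and integrated over an event of
   sigma(y, eta), the cross terms vanish because v - us is centred (even if v is
   not), and the noise term contributes E[(v - us)(v - us)'] = 2 var(v).  So the
   conditional expectation moves by 2 var(v) almost surely, and 2 var(fhat)
   exceeds 2 var(f) by the same amount: the two shifts cancel. *)
Require Import Defs.
From HB Require Import structures.
From mathcomp Require Import all_boot all_order all_algebra.
From mathcomp Require Import all_classical all_reals all_analysis.
From mathcomp Require Import measurable_realfun ring.

Set Implicit Arguments.
Unset Strict Implicit.
Unset Printing Implicit Defensive.

Import Order.TTheory GRing.Theory Num.Theory.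
Import numFieldNormedType.Exports.

Local Open Scope classical_set_scope.
Local Open Scope ring_scope.

(** * Measurability of matrix-valued maps *)

Section matrix_measurability.
Context d (T : measurableType d) (R : realType) (m n : nat).

Lemma measurable_mx_entry (i : 'I_m) (j : 'I_n) :
  measurable_fun setT (fun A : 'M[R]_(m, n) => A i j).
Proof.
move=> _ B mB; apply: sub_sigma_algebra.
by exists (i, j) => //=; exists B.
Qed.

(** The sigma-algebra on matrices is generated by preimages under the entries, so checking these
    generators suffices. *)
Lemma measurable_fun_mx (X : T -> 'M[R]_(m, n)) :
  (forall i j, measurable_fun setT (fun w => X w i j)) -> measurable_fun setT X.
Proof.
move=> mX; pose G := \bigcup_(ij : 'I_m * 'I_n)
  preimage_set_system setT (fun A : 'M[R]_(m, n) => A ij.1 ij.2)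
    (@measurable _ (measurableTypeR R)).
apply: (measurability G) => // _ [_ [ij _ [B mB <-]] <-].
by rewrite setTI; exact: mX.
Qed.

Lemma measurable_fun_mx_entry (X : T -> 'M[R]_(m, n)) i j :
  measurable_fun setT X -> measurable_fun setT (fun w => X w i j).
Proof. exact: (measurableT_comp (measurable_mx_entry i j)). Qed.

End matrix_measurability.

Lemma measurable_mulmxl d (T : measurableType d) (R : realType) (m n k : nat)
    (A : 'M[R]_(m, n)) (X : T -> 'M[R]_(n, k)) :
  measurable_fun setT X -> measurable_fun setT (fun w => A *m X w).
Proof.
move=> mX; apply: measurable_fun_mx => i j.
under eq_fun do rewrite mxE.
apply: measurable_sum => l; apply: measurable_funM => //.
exact: measurable_fun_mx_entry.
Qed.

Lemma measurable_preimageT d1 d2 (S1 : measurableType d1)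
    (S2 : measurableType d2) (X : S1 -> S2) A :
  measurable_fun setT X -> measurable A -> measurable (X @^-1` A).
Proof. by move=> mX mA; rewrite -[X in measurable X]setTI; exact: mX. Qed.

(** * Independence and equality in law *)

Section independence.
Context d (T : measurableType d) (R : realType) (P : probability T R).

Lemma independent2_comp d1 d2 d3 d4 (S1 : measurableType d1)
    (S2 : measurableType d2) (S3 : measurableType d3) (S4 : measurableType d4)
    (X : T -> S1) (Y : T -> S2) (g : S1 -> S3) (h : S2 -> S4) :
  measurable_fun setT g -> measurable_fun setT h ->
  independent2 P X Y -> independent2 P (g \o X) (h \o Y).
Proof.
move=> mg mh XY A B mA mB.
by apply: (XY (g @^-1` A) (h @^-1` B)); exact: measurable_preimageT.
Qed.

(** Dynkin's argument: rectangles are a pi-system generating the product sigma-algebra, and the sets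
    [S] obeying the product rule with [F] form a lambda-system. Fixing an event [F] rather than a
    variable lets the lemma be applied to one pair after another. *)
Lemma independent_event_pair d1 d2 (S1 : measurableType d1)
    (S2 : measurableType d2) (X : T -> S1) (Y : T -> S2) (F : set T) :
  measurable_fun setT X -> measurable_fun setT Y -> measurable F ->
  (forall A B, measurable A -> measurable B ->
    P (X @^-1` A `&` Y @^-1` B `&` F) =
    (P (X @^-1` A `&` Y @^-1` B) * P F)%E) ->
  forall S, measurable S ->
    P ((fun w => (X w, Y w)) @^-1` S `&` F) =
    (P ((fun w => (X w, Y w)) @^-1` S) * P F)%E.
Proof.
move=> mX mY mF XYF S mS; pose XY w := (X w, Y w).
have mXY : measurable_fun setT XY by exact: measurable_fun_pair.
apply: (@dynkin_induction _ _ [set A `*` B | A in measurable & B in measurable]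
  (fun S => P (XY @^-1` S `&` F) = (P (XY @^-1` S) * P F)%E)).
- exact: measurable_prod_measurableType.
- move=> _ _ [A1 mA1 [B1 mB1 <-]] [A2 mA2 [B2 mB2 <-]].
  rewrite -setXI; exists (A1 `&` A2); first exact: measurableI.
  by exists (B1 `&` B2) => //; exact: measurableI.
- by rewrite preimage_setT setTI probability_setT mul1e.
- by move=> _ [A mA [B mB <-]]; exact: XYF.
- move=> A mA IH; have mXYA := measurable_preimageT mXY mA.
  rewrite -[XY @^-1` (~` A)]/(~` (XY @^-1` A)) setIC -setDE.
  rewrite measureD//; last by rewrite ltey_eq fin_num_measure.
  rewrite setIC [X in (_ - X)%E]IH.
  by rewrite probability_setC// muleBl ?mul1e// ?fin_num_measure//.
- move=> G mG tG IH; have mXYG n := measurable_preimageT mXY (mG n).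
  have tXYG : trivIset setT (fun n => XY @^-1` G n).
    by move=> i j _ _ [w [Giw Gjw]]; apply: tG => //; exists (XY w).
  rewrite preimage_bigcup setI_bigcupl !measure_bigcup//; last 2 first.
  + by move=> n _; exact: measurableI.
  + exact: trivIset_setIr.
  (* Countable additivity leaves a series with constant factor [P F]; it is written as a real number
     so that it can be pulled out. *)
  rewrite muleC -(fineK (fin_num_measure P F mF)) -nneseriesZl//.
  by apply: eq_eseriesr => n _; rewrite [LHS]IH muleC fineK// fin_num_measure.
- by rewrite -measurable_prod_measurableType.
Qed.

(** On rectangles this is the triple product rule, combined with its instance at [setT] for [Z],
    which factors the law of the pair; the Dynkin argument extends it to all product events. *)
Lemma independent3_pair d1 d2 d3 (S1 : measurableType d1)
    (S2 : measurableType d2) (S3 : measurableType d3)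
    (X : T -> S1) (Y : T -> S2) (Z : T -> S3) :
  measurable_fun setT X -> measurable_fun setT Y -> measurable_fun setT Z ->
  independent3 P X Y Z -> independent2 P (fun w => (X w, Y w)) Z.
Proof.
move=> mX mY mZ XYZ S C mS mC.
apply: independent_event_pair => //; first exact: measurable_preimageT.
move=> A B mA mB; rewrite XYZ//; congr (_ * _)%E.
have := XYZ A B setT mA mB measurableT.
by rewrite preimage_setT setIT probability_setT mule1.
Qed.

(** Regroups four variables. With [a], [b] a signal and its noise and [c], [e] their copies, it
    separates both signals from both noises. On rectangles both sides are the same fourfold
    product. *)
Lemma independent2_pair d1 d2 d3 d4 (S1 : measurableType d1)
    (S2 : measurableType d2) (S3 : measurableType d3) (S4 : measurableType d4)
    (a : T -> S1) (b : T -> S2) (c : T -> S3) (e : T -> S4) :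
  measurable_fun setT a -> measurable_fun setT b ->
  measurable_fun setT c -> measurable_fun setT e ->
  independent2 P a b -> independent2 P c e ->
  independent2 P (fun w => (a w, b w)) (fun w => (c w, e w)) ->
  independent2 P (fun w => (a w, c w)) (fun w => (b w, e w)).
Proof.
move=> ma mb mc me ab ce abce.
have ac : independent2 P a c.
  exact: independent2_comp measurable_fst measurable_fst abce.
have be : independent2 P b e.
  exact: independent2_comp measurable_snd measurable_snd abce.
(* The Dynkin argument runs twice: first over events of [(b, e)] with the event of [(a, c)] fixed,
   then over events of [(a, c)] with a rectangle of [(b, e)] fixed. *)
move=> S1' S2' mS1 mS2; rewrite setIC muleC.
apply: independent_event_pair => //.
  by apply: measurable_preimageT mS1; exact: measurable_fun_pair.
move=> B D mB mD; rewrite setIC muleC.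
apply: independent_event_pair => //.
  by apply: measurableI; exact: measurable_preimageT.
move=> A C mA mC; rewrite setIACA ac// be//.
have := abce (A `*` B) (C `*` D) (measurableX mA mB) (measurableX mC mD).
rewrite [(_ @^-1` (A `*` B))]/(a @^-1` A `&` b @^-1` B).
rewrite [(_ @^-1` (C `*` D))]/(c @^-1` C `&` e @^-1` D) => ->.
by rewrite ab// ce// muleACA.
Qed.

Lemma same_law_comp d1 d2 (S1 : measurableType d1) (S2 : measurableType d2)
    (X Y : T -> S1) (h : S1 -> S2) :
  measurable_fun setT h -> same_law P X Y -> same_law P (h \o X) (h \o Y).
Proof.
move=> mh XY A mA; apply: (XY (h @^-1` A)).
exact: measurable_preimageT.
Qed.

(** Independence depends only on the joint law, since the marginal laws are its images under the
    projections. *)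
Lemma same_law_independent2 d1 d2 (S1 : measurableType d1)
    (S2 : measurableType d2) (X X' : T -> S1) (Y Y' : T -> S2) :
  same_law P (fun w => (X w, Y w)) (fun w => (X' w, Y' w)) ->
  independent2 P X Y -> independent2 P X' Y'.
Proof.
move=> eqXY XY A B mA mB.
rewrite -[LHS](eqXY (A `*` B) (measurableX mA mB)).
rewrite -(same_law_comp measurable_fst eqXY mA).
rewrite -(same_law_comp measurable_snd eqXY mB).
exact: XY.
Qed.

(** Change of variables turns both sides into integrals against the common law. This is done for
    nonnegative functions and then for the positive and negative parts of [h] separately. *)
Lemma same_law_integral d1 (S : measurableType d1) (X Y : T -> S)
    (h : S -> \bar R) :
  measurable_fun setT X -> measurable_fun setT Y -> measurable_fun setT h ->
  same_law P X Y -> (\int[P]_w h (X w) = \int[P]_w h (Y w))%E.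
Proof.
move=> mX mY mh XY.
pose X' : {mfun T >-> S} := mfun_Sub (mem_set mX).
pose Y' : {mfun T >-> S} := mfun_Sub (mem_set mY).
have ge0 (k : S -> \bar R) : measurable_fun setT k -> (forall s, 0 <= k s)%E ->
    (\int[P]_w k (X w) = \int[P]_w k (Y w))%E.
  move=> mk k0.
  rewrite -(@ge0_integral_distribution _ _ _ _ _ P X' k mk k0).
  rewrite -(@ge0_integral_distribution _ _ _ _ _ P Y' k mk k0).
  by apply: eq_measure_integral => A mA _; exact: XY.
rewrite integralE [RHS]integralE (funepos_comp h X) (funepos_comp h Y).
rewrite (funeneg_comp h X) (funeneg_comp h Y).
congr (_ - _)%E; apply: ge0 => //.
- exact: measurable_funepos.
- exact: measurable_funeneg.
Qed.

(** Independence makes the joint law the product of the marginal laws, and Fubini factors the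
    integral of the product. *)
Lemma expectation_independent2M (X Y : T -> R) :
  X \in Lfun P 1 -> Y \in Lfun P 1 -> X * Y \in Lfun P 1 ->
  independent2 P X Y -> ('E_P[X * Y] = 'E_P[X] * 'E_P[Y])%E.
Proof.
move=> X1 Y1 XY1 XY.
have mX : measurable_fun setT X by case/andP: X1 => /[!inE].
have mY : measurable_fun setT Y by case/andP: Y1 => /[!inE].
pose X' : {mfun T >-> R} := mfun_Sub (mem_set mX).
pose Y' : {mfun T >-> R} := mfun_Sub (mem_set mY).
pose Z : {mfun T >-> (R * R)%type} :=
  mfun_Sub (mem_set (measurable_fun_pair mX mY)).
pose mu := distribution P X'; pose nu := distribution P Y'.
(* Independence is agreement on rectangles; uniqueness of the product measure gives agreement
   everywhere. *)
have munuE A : measurable A -> (mu \x nu)%E A = distribution P Z A.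
  by apply: product_measure_unique => B C mB mC; exact: XY.
pose h (z : R * R) : \bar R := (z.1 * z.2)%:E.
have mh : measurable_fun setT h.
  apply/measurable_EFinP; apply: measurable_funM.
  - exact: measurable_fst.
  - exact: measurable_snd.
have iX : P.-integrable setT (EFin \o X) by apply/Lfun1_integrable.
have iY : P.-integrable setT (EFin \o Y) by apply/Lfun1_integrable.
have iXY : P.-integrable setT (h \o Z) by apply/Lfun1_integrable.
(* Fubini needs integrability under the product measure; it is carried over from the joint law. *)
have ih : (mu \x nu)%E.-integrable setT h.
  have /integrableP[_ hlty] := integrable_pushforward
    (measurable_funP Z) mh iXY measurableT.
  apply/integrableP; split => //.
  rewrite (eq_measure_integral (distribution P Z)).
    exact: hlty.
  by move=> A mA _; exact: munuE.
have imu : mu.-integrable setT EFin.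
  by apply: (integrable_pushforward (measurable_funP X')).
have inu : nu.-integrable setT EFin.
  by apply: (integrable_pushforward (measurable_funP Y')).
have EX : (\int[mu]_x x%:E = 'E_P[X])%E.
  by rewrite unlock (integral_distribution (X := X')).
have EY : (\int[nu]_x x%:E = 'E_P[Y])%E.
  by rewrite unlock (integral_distribution (X := Y')).
transitivity (\int[distribution P Z]_z h z)%E.
  by rewrite unlock integral_distribution.
rewrite -(eq_measure_integral (distribution P Z) (m1 := (mu \x nu)%E));
  last first.
  by move=> A mA _; exact: munuE.
rewrite -(integral12_prod_meas1 ih) /fubini_F -EX -EY.
transitivity (\int[mu]_x (x%:E * \int[nu]_y y%:E))%E.
  by apply: eq_integral => x _; rewrite -integralZl.
by rewrite EY -(fineK (expectation_fin_num Y1)) integralZr//.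
Qed.

Lemma covariance_independent2 (X Y : T -> R) :
  X \in Lfun P 2%:E -> Y \in Lfun P 2%:E ->
  independent2 P X Y -> covariance P X Y = 0%E.
Proof.
move=> X2 Y2 XY.
have Pfin : P setT \is a fin_num := fin_num_measure P _ measurableT.
have X1 := Lfun_subset12 Pfin X2.
have Y1 := Lfun_subset12 Pfin Y2.
have XY1 := Lfun2_mul_Lfun1 X2 Y2.
rewrite covarianceE// expectation_independent2M// subee//.
by rewrite fin_numM// expectation_fin_num.
Qed.

End independence.

(** * Moments, integrals over events, and uniqueness of conditional expectations *)

Section moments.
Context d (T : measurableType d) (R : realType) (P : probability T R).

Lemma Lfun_measurable (p : \bar R) (X : T -> R) :
  X \in Lfun P p -> measurable_fun setT X.
Proof. by case/andP => /[!inE]. Qed.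

Lemma Lfun2_Lfun1 (X : T -> R) : X \in Lfun P 2%:E -> X \in Lfun P 1.
Proof. by apply: Lfun_subset12; exact: fin_num_measure. Qed.

(** The 2-norm is determined by the integral of the squared absolute value, hence by the law. This
    gives the copies the second moments assumed for the originals. *)
Lemma same_law_Lfun2 (X Y : T -> R) :
  measurable_fun setT Y -> same_law P X Y ->
  X \in Lfun P 2%:E -> Y \in Lfun P 2%:E.
Proof.
move=> mY XY X2; have mX := Lfun_measurable X2.
have mh : measurable_fun setT (fun r : R => (`|r%:E| `^ 2)%E).
  apply: (measurableT_comp (measurable_poweR _)).
  by apply: measurableT_comp => //; exact/measurable_EFinP.
move: X2 => /andP[_]; rewrite !inE /finite_norm unlock /= => X2.
apply/andP; split; rewrite !inE//= /finite_norm unlock /=.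
by rewrite -(same_law_integral mX mY mh XY).
Qed.

Lemma same_law_covariance (X Y X' Y' : T -> R) :
  measurable_fun setT X -> measurable_fun setT Y ->
  measurable_fun setT X' -> measurable_fun setT Y' ->
  same_law P (fun w => (X w, Y w)) (fun w => (X' w, Y' w)) ->
  covariance P X Y = covariance P X' Y'.
Proof.
move=> mX mY mX' mY' XY.
have EX : ('E_P[X] = 'E_P[X'])%E.
  rewrite unlock; apply: (same_law_integral (h := EFin)) => //.
  exact: same_law_comp measurable_fst XY.
have EY : ('E_P[Y] = 'E_P[Y'])%E.
  rewrite unlock; apply: (same_law_integral (h := EFin)) => //.
  exact: same_law_comp measurable_snd XY.
rewrite covariance.unlock EX EY.
(* With the common means frozen as constants, the integrand becomes one fixed function of the
   pair. *)
move: (fine ('E_P[X'])%E) (fine ('E_P[Y'])%E) => x y.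
rewrite expectation.unlock.
apply: (same_law_integral (X := fun w => (X w, Y w))
  (Y := fun w => (X' w, Y' w)) (h := fun z : R * R =>
    ((z.1 - x) * (z.2 - y))%:E)) => //.
- exact: measurable_fun_pair.
- exact: measurable_fun_pair.
- apply/measurable_EFinP; apply: measurable_funM;
    by apply: measurable_funB => //; exact: measurable_cst.
Qed.

(** The indicator of an event of [G] is a function of [G], so it is absorbed into [v] and the
    product rule for expectations applies. *)
Lemma integral_independent2M d1 d2 (S1 : measurableType d1)
    (S2 : measurableType d2) (G : T -> S1) (H : T -> S2)
    (v : S1 -> R) (h : S2 -> R) (A : set S1) :
  measurable_fun setT G -> measurable_fun setT v -> measurable_fun setT h ->
  measurable A -> independent2 P G H ->
  v \o G \in Lfun P 1 -> h \o H \in Lfun P 1 ->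
  (v \o G) * (h \o H) \in Lfun P 1 ->
  (\int[P]_(w in G @^-1` A) (v (G w) * h (H w))%:E =
   \int[P]_(w in G @^-1` A) (v (G w))%:E * 'E_P[h \o H])%E.
Proof.
move=> mG mv mh mA GH v1 h1 vh1.
pose vA := v \* \1_A.
have mvA : measurable_fun setT vA by apply: measurable_funM.
have mGA : measurable (G @^-1` A) by exact: measurable_preimageT.
have L1A (X : T -> R) : X \in Lfun P 1 ->
    X \* (\1_A \o G) \in Lfun P 1.
  move=> /Lfun1_integrable iX; apply/Lfun1_integrable.
  rewrite (_ : _ \o _ = (EFin \o X) \_ (G @^-1` A)).
    apply/(integrable_mkcond _ mGA).
    by apply: (integrableS measurableT mGA) => //; exact: iX.
  by rewrite epatch_indic.
have IA (X : T -> R) : (\int[P]_(w in G @^-1` A) (X w)%:E =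
    'E_P[X \* (\1_A \o G)])%E.
  by rewrite unlock integral_mkcond (epatch_indic (EFin \o X)).
rewrite (IA (fun w => v (G w) * h (H w))) (IA (v \o G)).
rewrite -[X in ('E_P[X] * _)%E]/(vA \o G).
rewrite -expectation_independent2M//.
- by congr expectation; apply/funext => w /=; rewrite mulrAC.
- exact: L1A.
- rewrite (_ : _ * _ = (v \o G) * (h \o H) \* (\1_A \o G)).
    exact: L1A.
  by apply/funext => w; rewrite /vA !fctE mulrAC.
- exact: independent2_comp mvA mh GH.
Qed.

(** Almost sure uniqueness of conditional expectations: the sign of [Z - Z'] is itself an event of
    the sigma-algebra of [Y], which forces the integral of the absolute difference to vanish. *)
Lemma condexp_ae_eq d1 (S : measurableType d1) (Y : T -> S) (Z Z' : T -> R) :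
  measurable_fun setT Y ->
  measurable_fun setT (Z : g_sigma_algebra_preimageType Y -> R) ->
  measurable_fun setT (Z' : g_sigma_algebra_preimageType Y -> R) ->
  P.-integrable setT (EFin \o Z) -> P.-integrable setT (EFin \o Z') ->
  (forall A, g_sigma_algebra_preimage Y A ->
    \int[P]_(w in A) (Z w)%:E = \int[P]_(w in A) (Z' w)%:E)%E ->
  {ae P, forall w, Z w = Z' w}.
Proof.
move=> mY mZ mZ' iZ iZ' ZZ'.
have sY A : g_sigma_algebra_preimage Y A -> measurable A.
  by move=> [B mB <-]; apply: mY.
pose h w := Z w - Z' w.
have mh : measurable_fun setT (h : g_sigma_algebra_preimageType Y -> R).
  exact: measurable_funB.
have mhT : measurable_fun setT h.
  apply: measurable_funB; apply/measurable_EFinP.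
  - exact: measurable_int iZ.
  - exact: measurable_int iZ'.
have ih : P.-integrable setT (EFin \o h).
  exact: (integrableB measurableT iZ iZ').
have int0 A : g_sigma_algebra_preimage Y A -> (\int[P]_(w in A) (h w)%:E = 0)%E.
  move=> sA; have mA := sY _ sA.
  have iZA : P.-integrable A (EFin \o Z).
    exact: integrableS measurableT mA (@subsetT _ _) iZ.
  have iZA' : P.-integrable A (EFin \o Z').
    exact: integrableS measurableT mA (@subsetT _ _) iZ'.
  under eq_integral do rewrite EFinB.
  rewrite (integralB_EFin mA iZA iZA') ZZ'// subee//.
  exact: integrable_fin_num.
pose A := [set w | 0 <= h w].
have sA : g_sigma_algebra_preimage Y A.
  rewrite (_ : A = setT `&` h @^-1` `[0, +oo[); first exact: mh.
  by apply/seteqP; split=> w; rewrite /A /= in_itv/= andbT => // -[].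
have sAC : g_sigma_algebra_preimage Y (~` A).
  have := @measurableC _ (g_sigma_algebra_preimageType Y) _ sA; exact.
have /ae_eq_integral_abs : measurable_fun setT (EFin \o h).
  exact/measurable_EFinP.
move=> /(_ P measurableT)[+ _].
(* On [A] the absolute value is [h], on the complement it is [- h]; both integrals are zero by
   [int0]. *)
have -> : (\int[P]_w `|(EFin \o h) w| = 0)%E.
  rewrite -(setUv A) ge0_integral_setU//; last 4 first.
  - exact: sY.
  - exact: sY.
  - by rewrite setUv; apply: measurableT_comp => //; exact/measurable_EFinP.
  - by apply/disj_setPCl.
  rewrite (eq_integral (EFin \o h)); last first.
    by move=> w /[!inE]/= h0; rewrite ger0_norm.
  rewrite [X in (_ + X)%E](eq_integral (fun w => (- (h w)%:E)%E)); last first.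
    move=> w /[!inE]/= /negP; rewrite -ltNge => h0.
    by rewrite ltr0_norm.
  rewrite integralN/=; last first.
    apply: integrable_add_def; first exact: sY.
    exact: (integrableS measurableT (sY _ sAC) (@subsetT _ _) ih).
  by rewrite !int0// oppe0 adde0.
move=> /(_ erefl); apply: filterS => w /(_ I)/= [/eqP].
by rewrite subr_eq0 => /eqP.
Qed.

End moments.

(** * Differences between a variable and its independent copy *)

Lemma outer_diffE (T : Type) (R : realType) (n : nat) (X Y : T -> 'cV[R]_n)
    (w : T) i j :
  outer_diff X Y w i j = (X w i 0 - Y w i 0) * (X w j 0 - Y w j 0).
Proof. by rewrite !mxE big_ord1 !mxE. Qed.

Section centered_noise.
Context d (T : measurableType d) (R : realType) (P : probability T R).

Lemma expectationB_same_law (X Y : T -> R) :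
  X \in Lfun P 1 -> Y \in Lfun P 1 -> same_law P X Y ->
  ('E_P[X \- Y] = 0)%E.
Proof.
move=> X1 Y1 XY; rewrite expectationB//.
have -> : ('E_P[X] = 'E_P[Y])%E.
  rewrite unlock; apply: (same_law_integral (h := EFin)) => //.
  - exact: Lfun_measurable X1.
  - exact: Lfun_measurable Y1.
by rewrite subee// expectation_fin_num.
Qed.

(** Bilinearity gives four covariances: the two mixed ones vanish by independence of the copies, the
    other two coincide by equality of laws. *)
Lemma expectation_diffM_copy (X X' Y Y' : T -> R) :
  X \in Lfun P 2%:E -> X' \in Lfun P 2%:E ->
  Y \in Lfun P 2%:E -> Y' \in Lfun P 2%:E ->
  independent_copy P (fun w => (X w, Y w)) (fun w => (X' w, Y' w)) ->
  ('E_P[(X \- X') * (Y \- Y')] = 2%:E * covariance P X Y)%E.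
Proof.
move=> X2 X2' Y2 Y2' [XYlaw XYind].
have [mX mX'] := (Lfun_measurable X2, Lfun_measurable X2').
have [mY mY'] := (Lfun_measurable Y2, Lfun_measurable Y2').
have [X1 X1'] := (Lfun2_Lfun1 X2, Lfun2_Lfun1 X2').
have [Y1 Y1'] := (Lfun2_Lfun1 Y2, Lfun2_Lfun1 Y2').
have DX2 : X \- X' \in Lfun P 2%:E by rewrite rpredB ?lee1n.
have DY2 : Y \- Y' \in Lfun P 2%:E by rewrite rpredB ?lee1n.
have EX : ('E_P[X \- X'] = 0)%E.
  apply: expectationB_same_law => //.
  exact: same_law_comp measurable_fst XYlaw.
have cXY' : covariance P X Y' = 0%E.
  apply: covariance_independent2 => //.
  exact: independent2_comp measurable_fst measurable_snd XYind.
have cX'Y : covariance P X' Y = 0%E.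
  rewrite covarianceC; apply: covariance_independent2 => //.
  exact: independent2_comp measurable_snd measurable_fst XYind.
(* As [X \- X'] is centred, the expectation of the product is a covariance. *)
transitivity (covariance P (X \- X') (Y \- Y')).
  rewrite covarianceE ?EX ?mul0e ?sube0//; try exact: Lfun2_Lfun1.
  exact: Lfun2_mul_Lfun1.
rewrite covarianceBl// !covarianceBr// cXY' cX'Y sube0 sub0e oppeK.
rewrite -(same_law_covariance mX mY mX' mY' XYlaw).
have cfin : covariance P X Y \is a fin_num.
  by apply: covariance_fin_num => //; exact: Lfun2_mul_Lfun1.
by rewrite -(fineK cfin) -EFinD -EFinM mulr_natl mulr2n.
Qed.

Lemma measurable_dr_integrand_entry n (X : T -> 'cV[R]_n) (C : T -> 'M[R]_n)
    i j :
  (forall i j, measurable_fun setT (fun w => C w i j)) ->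
  measurable_fun setT (fun w => dr_integrand P X C w i j).
Proof.
move=> mC; under eq_fun do rewrite mxE.
apply: measurable_sum => k; apply: measurable_funM;
  under eq_fun do rewrite !mxE; exact: measurable_funB.
Qed.

End centered_noise.

(** * Effect of independent additive noise *)

Section additive_noise.
Context d (T : measurableType d) (R : realType) (P : probability T R).
Context dS (S : measurableType dS) (n : nat).
Variables (f v g u : T -> 'cV[R]_n) (y eta : T -> S).
Hypotheses (mf : measurable_fun setT f) (mv : measurable_fun setT v).
Hypotheses (mg : measurable_fun setT g) (m_u : measurable_fun setT u).
Hypotheses (my : measurable_fun setT y) (m_eta : measurable_fun setT eta).
Hypotheses (f2 : square_integrable P f) (v2 : square_integrable P v).
Hypothesis fyv : independent2 P (fun w => (f w, y w)) v.
Hypothesis copy : independent_copy P (fun w => (f w, y w, v w))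
                                     (fun w => (g w, eta w, u w)).

Let mfy : measurable_fun setT (fun w => (f w, y w)).
Proof. exact: measurable_fun_pair. Qed.

Let mgeta : measurable_fun setT (fun w => (g w, eta w)).
Proof. exact: measurable_fun_pair. Qed.

Let mentry i := @measurable_mx_entry R n 1 i 0.

Let g2 : square_integrable P g.
Proof.
move=> i; apply: same_law_Lfun2 (f2 i).
  exact: measurable_fun_mx_entry.
have fg : same_law P f g.
  exact: (same_law_comp measurable_fst (same_law_comp measurable_fst copy.1)).
exact: (same_law_comp (mentry i) fg).
Qed.

Let vu : same_law P v u.
Proof. exact: same_law_comp measurable_snd copy.1. Qed.

Let u2 : square_integrable P u.
Proof.
move=> i; apply: same_law_Lfun2 (v2 i).
  exact: measurable_fun_mx_entry.
exact: (same_law_comp (mentry i) vu).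
Qed.

(* The noise is independent of the conditioning variables and of the signal of
   both copies at once. *)
Let signal_noise : independent2 P (fun w => ((f w, y w), (g w, eta w)))
                                  (fun w => (v w, u w)).
Proof.
apply: (independent2_pair mfy mv mgeta m_u fyv _ copy.2).
exact: same_law_independent2 copy.1 fyv.
Qed.

Let df i w := f w i 0 - g w i 0.
Let dv i w := v w i 0 - u w i 0.

Let df2 i : df i \in Lfun P 2%:E.
Proof.
by have [fi gi] := (f2 i, g2 i); rewrite -[df i]/(_ \- _) rpredB ?lee1n.
Qed.

Let dv2 i : dv i \in Lfun P 2%:E.
Proof.
by have [vi ui] := (v2 i, u2 i); rewrite -[dv i]/(_ \- _) rpredB ?lee1n.
Qed.

Let dv_mean i : ('E_P[dv i] = 0)%E.
Proof.
apply: expectationB_same_law; [exact: Lfun2_Lfun1..|].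
exact: (same_law_comp (mentry i) vu).
Qed.

Let dvM i j :
  ('E_P[dv i * dv j] =
   2%:E * covariance P (fun w => v w i 0%R) (fun w => v w j 0%R))%E.
Proof.
apply: expectation_diffM_copy; [exact: v2|exact: u2|exact: v2|exact: u2|].
have mij : measurable_fun setT (fun z : 'cV[R]_n => (z i 0, z j 0)).
  exact: measurable_fun_pair.
split; first exact: (same_law_comp mij vu).
have vu_indep : independent2 P v u.
  exact: (independent2_comp measurable_snd measurable_snd copy.2).
exact: (independent2_comp mij mij vu_indep).
Qed.

Let mA A : g_sigma_algebra_preimage (fun w => (y w, eta w)) A -> measurable A.
Proof. by move=> [B mB <-]; exact: measurable_fun_pair. Qed.

(** An event of the sigma-algebra of [(y, eta)] is also an event of the two signal pairs, so on it a
    noise factor [W] can be replaced by its mean. *)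
Let integral_noise (a : ('cV[R]_n * S) * ('cV[R]_n * S) -> R)
    (b : 'cV[R]_n * 'cV[R]_n -> R) A :
  measurable_fun setT a -> measurable_fun setT b ->
  let V w := a ((f w, y w), (g w, eta w)) in let W w := b (v w, u w) in
  V \in Lfun P 1 -> W \in Lfun P 1 -> V * W \in Lfun P 1 ->
  g_sigma_algebra_preimage (fun w => (y w, eta w)) A ->
  (\int[P]_(w in A) (V w * W w)%:E = \int[P]_(w in A) (V w)%:E * 'E_P[W])%E.
Proof.
move=> ma mb V W V1 W1 VW1 [B mB <-].
(* [k] extracts the conditioning variables from the two signal pairs, exhibiting the event as one of
   the latter. *)
pose k (z : ('cV[R]_n * S) * ('cV[R]_n * S)) := (z.1.2, z.2.2).
have mk : measurable_fun setT k.
  by apply: measurable_fun_pair; exact: measurableT_comp.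
rewrite setTI.
apply: (integral_independent2M (A := k @^-1` B) _ ma mb _ signal_noise) => //.
- exact: measurable_fun_pair.
- exact: measurable_preimageT.
Qed.

Let mdf i : measurable_fun setT
  (fun z : ('cV[R]_n * S) * ('cV[R]_n * S) => z.1.1 i 0 - z.2.1 i 0).
Proof.
apply: measurable_funB.
- by apply: (measurableT_comp (mentry i)); exact: measurableT_comp.
- by apply: (measurableT_comp (mentry i)); exact: measurableT_comp.
Qed.

Let mdv i : measurable_fun setT
  (fun z : 'cV[R]_n * 'cV[R]_n => z.1 i 0 - z.2 i 0).
Proof. by apply: measurable_funB; exact: (measurableT_comp (mentry i)). Qed.

Let cross i j A : g_sigma_algebra_preimage (fun w => (y w, eta w)) A ->
  (\int[P]_(w in A) (df i w * dv j w)%:E = 0)%E.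
Proof.
move=> sA.
have := integral_noise (mdf i) (mdv j) (Lfun2_Lfun1 (df2 i))
  (Lfun2_Lfun1 (dv2 j)) (Lfun2_mul_Lfun1 (df2 i) (dv2 j)) sA.
by rewrite [X in (_ * X)%E]dv_mean mule0.
Qed.

Let vcov i j := fine (covariance P (fun w => v w i 0) (fun w => v w j 0)).

Let covK i j :
  (vcov i j)%:E = covariance P (fun w => v w i 0) (fun w => v w j 0).
Proof.
rewrite fineK//; apply: covariance_fin_num; last exact: Lfun2_mul_Lfun1.
- exact: Lfun2_Lfun1.
- exact: Lfun2_Lfun1.
Qed.

Let noise i j A : g_sigma_algebra_preimage (fun w => (y w, eta w)) A ->
  (\int[P]_(w in A) (dv i w * dv j w)%:E =
   \int[P]_(w in A) (2 * vcov i j)%:E)%E.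
Proof.
move=> sA.
have mb : measurable_fun setT (fun z : 'cV[R]_n * 'cV[R]_n =>
    (z.1 i 0 - z.2 i 0) * (z.1 j 0 - z.2 j 0)) by apply: measurable_funM.
have vv1 := Lfun2_mul_Lfun1 (dv2 i) (dv2 j).
have onevv : cst 1 * (dv i \* dv j) \in Lfun P 1.
  by rewrite (_ : cst 1 * _ = dv i \* dv j)//; apply/funext => w;
    rewrite !fctE mul1r.
(* The factor 1 plays the role of the signal part in [integral_noise]. *)
transitivity (\int[P]_(w in A) (1 * (dv i w * dv j w))%:E)%E.
  by apply: eq_integral => w _; rewrite mul1r.
have m1 : measurable_fun setT
  (cst 1 : ('cV[R]_n * S) * ('cV[R]_n * S) -> R) by [].
have := integral_noise m1 mb
  (Lfun_cst P 1 1) vv1 onevv sA.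
move=> ->; rewrite [X in (_ * X)%E]dvM -covK -EFinM.
rewrite (integral_cst P (mA sA) 1%E) mul1e muleC.
by rewrite (integral_cst P (mA sA) (2 * vcov i j)%:E).
Qed.

(** Signal and noise are independent, so the cross covariances vanish in the bilinear expansion. *)
Lemma covariance_mx_add_noise i j :
  covariance_mx P (fun w => f w + v w) i j =
  covariance_mx P f i j + covariance_mx P v i j.
Proof.
rewrite !mxE.
have fE k :
    (fun w => (f w + v w) k 0) = (fun w => f w k 0) \+ (fun w => v w k 0).
  by apply/funext => w; rewrite mxE.
have fv k l : covariance P (fun w => f w k 0) (fun w => v w l 0) = 0%E.
  apply: covariance_independent2; [exact: f2|exact: v2|].
  have mk := measurableT_comp (mentry k) (@measurable_fst _ _ _ S).
  exact: (independent2_comp mk (mentry l) fyv).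
have [fi fj] := (f2 i, f2 j); have [vi vj] := (v2 i, v2 j).
rewrite !fE covarianceDl ?rpredD ?lee1n// !covarianceDr// fv.
rewrite (covarianceC P (fun w => v w i 0)) fv adde0 add0e fineD//.
- apply: covariance_fin_num; last exact: Lfun2_mul_Lfun1.
  + exact: Lfun2_Lfun1.
  + exact: Lfun2_Lfun1.
- by rewrite -covK.
Qed.

(** Entrywise, [C] plus the constant satisfies the integral identities that characterise [D], so
    almost sure uniqueness applies. *)
Lemma condexp_add_noise (C D : T -> 'M[R]_n) :
  is_condexp_mx P (outer_diff f g) (fun w => (y w, eta w)) C ->
  is_condexp_mx P (outer_diff (fun w => f w + v w) (fun w => g w + u w))
    (fun w => (y w, eta w)) D ->
  {ae P, forall w, D w = C w + 2 *: covariance_mx P v}.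
Proof.
move=> hC hD.
have key i j : {ae P, forall w, D w i j = C w i j + 2 * vcov i j}.
  have [mC iC intC] := hC i j; have [mD iD intD] := hD i j.
  have icst : P.-integrable setT (EFin \o cst (2 * vcov i j)).
    exact: finite_measure_integrable_cst.
  apply: (condexp_ae_eq (Y := fun w => (y w, eta w))) => //.
  - exact: measurable_fun_pair.
  - exact: measurable_funD.
  - exact: (integrableD measurableT iC icst).
  move=> A sA; have mAA := mA sA; rewrite intD//.
  have SA (X : T -> R) : X \in Lfun P 1 -> P.-integrable A (EFin \o X).
    by move=> /Lfun1_integrable; apply: integrableS.
  have ff := SA _ (Lfun2_mul_Lfun1 (df2 i) (df2 j)).
  have fv := SA _ (Lfun2_mul_Lfun1 (df2 i) (dv2 j)).
  have vf := SA _ (Lfun2_mul_Lfun1 (df2 j) (dv2 i)).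
  have vv := SA _ (Lfun2_mul_Lfun1 (dv2 i) (dv2 j)).
  (* Since each coordinate difference is [df + dv], the product splits into a signal term, two cross
     terms and a noise term; both cross terms are written signal first, to match [cross]. *)
  transitivity (\int[P]_(w in A) ((df i w * df j w)%:E +
     ((df i w * dv j w)%:E + ((df j w * dv i w)%:E + (dv i w * dv j w)%:E))))%E.
    apply: eq_integral => w _; rewrite outer_diffE -!EFinD !mxE /df /dv.
    by congr _%:E; ring.
  rewrite integralD//; last first.
    by apply: integrableD => //; exact: integrableD.
  rewrite integralD//; last exact: integrableD.
  rewrite integralD// !cross// !add0e noise//.
  under [RHS]eq_integral do rewrite EFinD.
  rewrite integralD//; last 2 first.
  - exact: integrableS iC.
  - exact: integrableS icst.
  rewrite intC//; congr (_ + _)%E.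
  by apply: eq_integral => w _; rewrite outer_diffE.
(* Finitely many exceptional null sets, one per entry, are merged into one. *)
have : {ae P, forall w, forall ij : 'I_n * 'I_n,
    D w ij.1 ij.2 = C w ij.1 ij.2 + 2 * vcov ij.1 ij.2}.
  by apply: filter_forall => -[i j]; exact: key.
apply: filterS => w h; apply/matrixP => i j.
by rewrite (h (i, j)) !mxE.
Qed.

(** The two random matrices under the expectation agree almost surely before squaring, so their
    measurable entries have equal integrals. *)
Lemma dr_matrix_add_noise (C D : T -> 'M[R]_n) :
  is_condexp_mx P (outer_diff f g) (fun w => (y w, eta w)) C ->
  is_condexp_mx P (outer_diff (fun w => f w + v w) (fun w => g w + u w))
    (fun w => (y w, eta w)) D ->
  dr_matrix P f C = dr_matrix P (fun w => f w + v w) D.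
Proof.
move=> hC hD; apply/matrixP => i j; rewrite !mxE unlock; congr fine.
have mC k l : measurable_fun setT (fun w => C w k l).
  have [_ ikl _] := hC k l; apply/measurable_EFinP.
  exact: measurable_int ikl.
have mD k l : measurable_fun setT (fun w => D w k l).
  have [_ ikl _] := hD k l; apply/measurable_EFinP.
  exact: measurable_int ikl.
apply: ae_eq_integral => //.
- by apply/measurable_EFinP; exact: measurable_dr_integrand_entry.
- by apply/measurable_EFinP; exact: measurable_dr_integrand_entry.
have := condexp_add_noise hC hD; apply: filterS => w Dw _; congr (_%:E).
rewrite /dr_integrand Dw.
have -> : covariance_mx P (fun w => f w + v w) =
    covariance_mx P f + covariance_mx P v.
  by apply/matrixP => k l; rewrite [RHS]mxE; exact: covariance_mx_add_noise.
(* The term [2 *: covariance_mx P v] enters once with each sign and cancels. *)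
by rewrite scalerDr opprD addrACA subrr addr0.
Qed.

End additive_noise.

(** * Reduction of the factor model to additive noise *)

Theorem lemma1 (R : realType) (d : measure_display) (T : measurableType d)
    (P : probability T R)
    (dE : measure_display) (E : measurableType dE)
    (K L p : nat)
    (f : {RV P >-> 'cV[R]_K}) (u : {RV P >-> 'cV[R]_p}) (eps : {RV P >-> E})
    (y : {RV P >-> R}) (x : {RV P >-> 'cV[R]_p})
    (phi : 'I_L -> 'cV[R]_K) (g : 'cV[R]_L * E -> R)
    (hg : measurable_fun setT g)
    (hy : forall w, y w = g (\col_l ((phi l)^T *m f w) 0 0, eps w))
    (B : 'M[R]_(p, K)) (hB : B^T *m B \in unitmx)
    (hx : forall w, x w = B *m f w + u w)
    (hindep : independent3 P f u eps)
    (fhat ustar : T -> 'cV[R]_K)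
    (hfhat : forall w, fhat w = least_squares B (x w))
    (hustar : forall w, ustar w = least_squares B (u w))
    (gs us : {RV P >-> 'cV[R]_K}) (eta : {RV P >-> R})
    (hcopy : independent_copy P (fun w => (f w, y w, ustar w))
                                (fun w => (gs w, eta w, us w)))
    (ghat : T -> 'cV[R]_K) (hghat : forall w, ghat w = gs w + us w)
    (C Chat : T -> 'M[R]_K)
    (hC : is_condexp_mx P (outer_diff f gs) (fun w => (y w, eta w)) C)
    (hChat : is_condexp_mx P (outer_diff fhat ghat) (fun w => (y w, eta w)) Chat)
    (hf2 : square_integrable P f) (hfhat2 : square_integrable P fhat)
    (hM : integrable_mx P (dr_integrand P f C)) :
  dr_matrix P f C = dr_matrix P fhat Chat.
Proof.
have mustar : measurable_fun setT ustar.
  by rewrite (funext hustar); exact: measurable_mulmxl.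
(* Least squares recovers [f] exactly from [B *m f], because [B^T *m B] is invertible. *)
have fhatE w : fhat w = f w + ustar w.
  rewrite hfhat hustar hx /least_squares mulmxDr; congr (_ + _).
  by rewrite mulmxA -(mulmxA (invmx _)) mulVmx// mul1mx.
(* The second moments of the projected noise come from writing it as [fhat - f]. *)
have ustar2 : square_integrable P ustar.
  move=> i; have [fi fhati] := (hf2 i, hfhat2 i).
  rewrite (_ : (fun w => ustar w i 0) =
      (fun w => fhat w i 0) \- (fun w => f w i 0)).
    by rewrite rpredB ?lee1n.
  by apply/funext => w; rewrite /= fhatE mxE addrAC subrr add0r.
have fy_ustar : independent2 P (fun w => (f w, y w)) ustar.
  (* [k] sends [(f, eps)] to [(f, y)], while [ustar] is a function of [u]; independence of
     [(f, eps)] and [u] therefore passes to these images. *)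
  pose k (z : 'cV[R]_K * E) := (z.1, g (\col_l ((phi l)^T *m z.1) 0 0, z.2)).
  have mk : measurable_fun setT k.
    apply: measurable_fun_pair => //; apply: (measurableT_comp hg).
    apply: measurable_fun_pair => //; apply: measurable_fun_mx => i j.
    under eq_fun do rewrite mxE.
    by apply: measurable_fun_mx_entry; exact: measurable_mulmxl.
  have ml : measurable_fun setT (@least_squares R p K B).
    exact: measurable_mulmxl.
  have indep : independent2 P (fun w => (f w, eps w)) u.
    apply: independent3_pair => // A1 A2 A3 mA1 mA2 mA3.
    (* Mutual independence is reordered so that [f] and [eps] form the pair. *)
    by rewrite setIAC hindep// muleAC.
  have := independent2_comp mk ml indep.
  have -> : k \o (fun w => (f w, eps w)) = (fun w => (f w, y w)).
    by apply/funext => w; rewrite /k /= hy.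
  by have -> : least_squares B \o u = ustar
    by apply/funext => w; rewrite hustar.
rewrite (funext fhatE) (funext hghat) in hChat *.
exact: (dr_matrix_add_noise (measurable_funP f) mustar (measurable_funP gs)
  (measurable_funP us) (measurable_funP y) (measurable_funP eta) hf2 ustar2
  fy_ustar hcopy hC hChat).
Qed.
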